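(* If $G$ is a finite $4$-centralizer group, then $G$ is commuting integral.
   Context: For an element $x$ of a group $G$, $C_G(x)=\{y\in G: xy=yx\}$ is its centralizer. Let $\operatorname{Cent}(G)=\{C_G(x): x\in G\}$ be the set of distinct element centralizers (including $G$ itself, the centralizer of central elements). $G$ is called an $n$-centralizer group if $|\operatorname{Cent}(G)|=n$. For a non-abelian group $G$ with center $Z(G)$, the commuting graph $\Gamma_G$ is the simple undirected graph with vertex set $G\setminus Z(G)$ in which two distinct vertices $x,y$ are adjacent if and only if $xy=yx$. A finite graph is integral if all eigenvalues of its adjacency matrix are integers. A finite non-abelian group $G$ is called commuting integral if $\Gamma_G$ is integral. *)

(* Defs.v *)
From HB Require Import structures.
From mathcomp Require Import all_boot all_order all_fingroup all_algebra.
From mathcomp Require Import all_solvable all_field.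

Set Implicit Arguments.
Unset Strict Implicit.
Unset Printing Implicit Defensive.

Import GroupScope.

Record sgraph := SGraph {
  vertex : finType;
  edge : rel vertex;
  edge_sym : symmetric edge;
  edge_irrefl : irreflexive edge }.

(* Vertices are numbered by [enum_val]; another numbering conjugates the matrix
   by a permutation matrix. *)
Definition adjacency_mx (F : nzRingType) (X : sgraph) : 'M[F]_#|vertex X| :=
  (\matrix_(i, j) (edge (enum_val i) (enum_val j))%:R)%R.

(* Every complex eigenvalue of a 0/1 matrix is an algebraic number, so [algC]
   contains the whole spectrum. *)
Definition integral_graph (X : sgraph) : Prop :=
  forall a : algC, eigenvalue (adjacency_mx algC X) a -> a \in Num.int.

Section Centralizers.

Variables (gT : finGroupType) (G : {group gT}).

Definition Cent : {set {set gT}} := [set 'C_G[x] | x in G].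

Definition n_centralizer (n : nat) : Prop := #|Cent| = n.

Definition noncentral : finType := {x : gT | x \in G :\: 'Z(G)}.

Definition commuting_rel : rel noncentral :=
  fun x y => (x != y) && (val x * val y == val y * val x).

Lemma commuting_rel_sym : symmetric commuting_rel.
Proof. by move=> x y; rewrite /commuting_rel eq_sym [_ * _ == _]eq_sym. Qed.

Lemma commuting_rel_irrefl : irreflexive commuting_rel.
Proof. by move=> x; rewrite /commuting_rel eqxx. Qed.

Definition commuting_graph : sgraph :=
  SGraph commuting_rel_sym commuting_rel_irrefl.

(* The notion is only defined for non-abelian groups, hence the first conjunct. *)
Definition commuting_integral : Prop :=
  ~~ abelian G /\ integral_graph commuting_graph.

End Centralizers.

(* Main.v *)
Require Import Defs.
From mathcomp Require Import all_boot all_fingroup.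
From mathcomp Require Import all_algebra all_solvable all_field.

(** In a group with at most four element centralizers, commuting is transitive
on noncentral elements.  Indeed, if a noncentral [x] commutes with two elements
[y] and [z] that do not commute with each other, then [G], [C(x)], [C(y)],
[C(z)] and [C(yz)] are five distinct centralizers: [C(x)] is proper and contains
[y] and [z], [C(y)] contains only [y], [C(z)] contains only [z], and [C(yz)]
contains neither ([not_commute_card_Cent]).

The commuting graph is therefore a disjoint union of cliques, and such a graph
is integral ([cluster_graph_integral]): if [A] is its adjacency matrix, then
[A + 1] sums a vector over each clique, so that its image consists of vectors
that are constant on cliques.  An eigenvector of [A + 1] with nonzero eigenvalue
lies in this image, and its eigenvalue is the size of a clique on which it does
not vanish. *)

Set Implicit Arguments.
Unset Strict Implicit.
Unset Printing Implicit Defensive.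

Import GRing.Theory Num.Theory.

Section ClusterGraph.

Variable X : sgraph.

Let adj (u v : vertex X) := (u == v) || edge u v.

Local Open Scope ring_scope.

(** The reflexive closure of the edge relation is what [A + 1] encodes. *)
Lemma mulmx_adjacency_mx (F : nzRingType) (v : 'rV[F]_#|vertex X|) j :
  (v *m adjacency_mx F X) 0 j + v 0 j
    = \sum_(i | adj (enum_val i) (enum_val j)) v 0 i.
Proof.
rewrite (bigD1 j) /=; last by rewrite /adj eqxx.
rewrite mxE (bigD1 j) //= mxE edge_irrefl mulr0 add0r addrC; congr (_ + _).
rewrite big_mkcond [RHS]big_mkcond; apply: eq_bigr => i _.
rewrite mxE /adj (inj_eq enum_val_inj).
by case: (i == j); case: edge; rewrite /= ?mulr1 ?mulr0.
Qed.

(** The sum of [v] over the clique of [j] depends only on that clique, and it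
equals [(a + 1) * v j].  Hence either [a = -1], or [v] is itself constant on
cliques and [a + 1] is the size of any clique where [v] is nonzero. *)
Lemma cluster_graph_integral : transitive adj -> integral_graph X.
Proof.
move=> adjT a /eigenvalueP[v vA v_neq0].
have adjS : symmetric adj by move=> u w; rewrite /adj eq_sym edge_sym.
have vM j :
    (a + 1) * v 0 j = \sum_(i | adj (enum_val i) (enum_val j)) v 0 i.
  by rewrite -mulmx_adjacency_mx vA mxE mulrDl mul1r.
have [/eqP|a1_neq0] := eqVneq (a + 1) 0.
  by rewrite addr_eq0 => /eqP->; rewrite rpredN rpred1.
have v_cst (i j : 'I_#|vertex X|) :
    adj (enum_val i) (enum_val j) -> v 0 i = v 0 j.
  move=> adj_ij; apply: (mulfI a1_neq0); rewrite !vM.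
  apply: eq_bigl => k; apply/idP/idP => [/adjT|/adjT]; first exact.
  by apply; rewrite adjS.
have /rV0Pn[j vj_neq0] := v_neq0.
have : (a + 1) * v 0 j
    = #|[pred i : 'I_#|vertex X| | adj (enum_val i) (enum_val j)]|%:R * v 0 j.
  by rewrite vM (eq_bigr _ (fun i => @v_cst i j)) sumr_const mulr_natl.
move/(mulIf vj_neq0)/(canRL (addrK 1)) ->.
by rewrite rpredB ?rpred1 ?rpred_nat.
Qed.

End ClusterGraph.

Section FewCentralizers.

Variables (gT : finGroupType) (G : {group gT}).

Local Open Scope group_scope.

Lemma abelian_card_Cent : abelian G -> #|Cent G| = 1%N.
Proof.
move=> abG; rewrite -(cards1 (G : {set gT})); congr #|pred_of_set _|.
apply/setP=> A; rewrite inE; apply/imsetP/eqP => [[x Gx ->]|->].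
  by apply/setIidPl; rewrite sub_cent1 (subsetP abG).
exists 1; first exact: group1.
by rewrite cent11T setIT.
Qed.

(** The element [y * z] commutes with neither factor, which is what separates
its centralizer from those of [x], [y] and [z]. *)
Lemma not_commute_card_Cent x y z :
    x \in G :\: 'Z(G) -> y \in G -> z \in G ->
  commute x y -> commute x z -> ~ commute y z -> 4 < #|Cent G|.
Proof.
case/setDP=> Gx Z'x Gy Gz cxy cxz ncyz.
have Cx : 'C_G[x] != G.
  apply: contraNneq Z'x => eqCG; rewrite inE Gx /=.
  by rewrite -sub_cent1; apply/setIidPl.
have yx : y \in 'C_G[x] by rewrite inE Gy; apply/cent1P.
have zx : z \in 'C_G[x] by rewrite inE Gz; apply/cent1P.
have yy : y \in 'C_G[y] by rewrite inE Gy cent1id.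
have zz : z \in 'C_G[z] by rewrite inE Gz cent1id.
have zy : z \notin 'C_G[y] by rewrite inE Gz cent1C /=; apply/cent1P.
have yz : y \notin 'C_G[z] by rewrite inE Gy /=; apply/cent1P.
have y_yz : y \notin 'C_G[y * z].
  by rewrite inE Gy cent1C /= groupMl ?cent1id // cent1C; apply/cent1P.
have z_yz : z \notin 'C_G[y * z].
  by rewrite inE Gz cent1C /= groupMr ?cent1id //; apply/cent1P.
have neqP w (A B : {set gT}) : w \in A -> w \notin B -> (A == B) = false.
  by move=> Aw; apply: contraNF => /eqP <-.
pose s : seq {set gT} :=
  [:: G : {set gT}; 'C_G[x]; 'C_G[y]; 'C_G[z]; 'C_G[y * z]].
have uniq_s : uniq s.
  rewrite /= !inE [_ == 'C_G[x]]eq_sym (negPf Cx).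
  rewrite (neqP z G _ Gz zy) (neqP y G _ Gy yz) (neqP y G _ Gy y_yz).
  rewrite (neqP z _ _ zx zy) (neqP y _ _ yx yz) (neqP y _ _ yx y_yz).
  by rewrite (neqP y _ _ yy yz) (neqP y _ _ yy y_yz) (neqP z _ _ zz z_yz).
rewrite cardE; apply: (uniq_leq_size uniq_s) => A.
have Cent_in u : u \in G -> 'C_G[u] \in Cent G by apply: imset_f.
have GC : (G : {set gT}) \in Cent G.
  by have := Cent_in 1 (group1 G); rewrite cent11T setIT.
rewrite mem_enum !inE => /or4P[|||/orP[]] /eqP-> //; apply: Cent_in => //.
exact: groupM.
Qed.

Lemma commuting_graph_integral :
  #|Cent G| <= 4 -> integral_graph (commuting_graph G).
Proof.
move=> leCent4; apply: cluster_graph_integral.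
have adjP (u v : noncentral G) :
    reflect (commute (val u) (val v)) ((u == v) || commuting_rel u v).
  rewrite /commuting_rel; have [->|_] /= := eqVneq u v; first by left.
  exact: eqP.
move=> x y z /adjP cyx /adjP cxz; apply/adjP/eqP/contraT => /eqP ncyz.
have inG (u : noncentral G) : val u \in G by case/setDP: (valP u).
rewrite leqNgt in leCent4; case/negP: leCent4.
exact: not_commute_card_Cent (valP x) (inG y) (inG z) (commute_sym cyx) cxz ncyz.
Qed.

End FewCentralizers.

Theorem corollary2p3 (gT : finGroupType) (G : {group gT}) :
  n_centralizer G 4 -> commuting_integral G.
Proof.
move=> Cent4; split; last by apply: commuting_graph_integral; rewrite Cent4.
by apply/negP => /abelian_card_Cent; rewrite Cent4.
Qed.
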